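(* Let $(X_i)_{i\in I}$ be a family of multipointed $d$-spaces and let $(f_i:(|X_i|,X_i^0)\to(|X|,X^0))_{i\in I}$ be a cocone of multipointed spaces (continuous maps $|X_i|\to|X|$ sending $X_i^0$ into $X^0$). Let $X$ be the $\Omega$-final lift, i.e. the multipointed $d$-space structure on $(|X|,X^0)$ whose set of execution paths is the smallest one making every $f_i$ a map of multipointed $d$-spaces. Then the set of execution paths of $X$ is exactly the set of finite Moore compositions $(f_{i_1}\gamma_1\mu_{\ell_1})*\dots*(f_{i_n}\gamma_n\mu_{\ell_n})$ with $n\ge1$, $i_1,\dots,i_n\in I$, $\gamma_k$ an execution path of $X_{i_k}$ for each $k$, $\ell_1,\dots,\ell_n>0$ with $\sum_k\ell_k=1$ (and consecutive terms composable).
   Context: Work in $\mathbf{Top}$, the category of $\Delta$-generated spaces (or $\Delta$-Hausdorff $\Delta$-generated spaces). $\mathcal{G}(1,1)$: nondecreasing homeomorphisms of $[0,1]$. $\mu_\ell:[0,\ell]\to[0,1]$, $t\mapsto t/\ell$. Moore composition: for $\gamma_k:[0,\ell_k]\to U$ with $\gamma_k(\ell_k)=\gamma_{k+1}(0)$, $\gamma_1*\dots*\gamma_n:[0,\sum\ell_k]\to U$ is $t\mapsto\gamma_k(t-\sum_{j<k}\ell_j)$ on $[\sum_{j<k}\ell_j,\sum_{j\le k}\ell_j]$. Normalized composition of paths on $[0,1]$: $(\gamma_1*_N\gamma_2)(t)=\gamma_1(2t)$ for $t\le1/2$, $\gamma_2(2t-1)$ for $t\ge1/2$. A multipointed $d$-space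 $X=(|X|,X^0,\mathbb{P}^{\mathcal{G}}X)$ consists of a space $|X|$, a subset $X^0$ (states) and a set of continuous maps $[0,1]\to|X|$ (execution paths) with endpoints in $X^0$, stable under precomposition by elements of $\mathcal{G}(1,1)$ and under normalized composition of composable paths. Maps are continuous maps preserving states and execution paths. *)

(* Defs.v *)
From HB Require Import structures.
From mathcomp Require Import all_boot all_order all_algebra.
From mathcomp Require Import all_classical all_reals all_analysis.
From mathcomp Require Import Rstruct Rstruct_topology.
From Stdlib Require Import Rdefinitions.

Set Implicit Arguments.
Unset Strict Implicit.
Unset Printing Implicit Defensive.
Import Order.TTheory GRing.Theory Num.Theory.
Local Open Scope classical_set_scope.
Local Open Scope ring_scope.

(* The segment [0,1] with its subspace topology (initial topology of the
   inclusion into R). *)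
Definition I01 : topologicalType := set_type (`[0, 1]%classic : set R).

Lemma clamp01_in (x : R) : Num.min 1 (Num.max 0 x) \in (`[0, 1]%classic : set R).
Proof.
apply/mem_set; rewrite /= in_itv /=; apply/andP; split.
- by rewrite le_min ler01 le_max lexx.
- by rewrite ge_min lexx.
Qed.

Definition clamp01 (x : R) : I01 := SigSub (clamp01_in x).

Definition i0 : I01 := clamp01 0.
Definition i1 : I01 := clamp01 1.

Definition G11 (phi : I01 -> I01) : Prop :=
  continuous phi /\
  (exists psi : I01 -> I01, continuous psi /\ cancel phi psi /\ cancel psi phi) /\
  (forall s t : I01, set_val s <= set_val t -> set_val (phi s) <= set_val (phi t)).

Definition ncomp (T : Type) (g1 g2 : I01 -> T) : I01 -> T :=
  fun t => if set_val t <= 1 / 2 then g1 (clamp01 (2 * set_val t))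
           else g2 (clamp01 (2 * set_val t - 1)).

Definition mdspace_axioms (T : topologicalType) (X0 : set T)
    (P : set (I01 -> T)) : Prop :=
  [/\ (forall g, P g -> continuous g),
      (forall g, P g -> X0 (g i0) /\ X0 (g i1)),
      (forall g phi, P g -> G11 phi -> P (g \o phi)) &
      (forall g1 g2, P g1 -> P g2 -> g1 i1 = g2 i0 -> P (ncomp g1 g2))].

Record MdSpace := {
  md_carrier : topologicalType;
  md_states : set md_carrier;
  md_paths : set (I01 -> md_carrier);
  md_ax : mdspace_axioms md_states md_paths }.
Arguments md_states : clear implicits.
Arguments md_paths : clear implicits.

(* Delta-generated spaces: topology final w.r.t. continuous maps [0,1] -> T
   (equivalent to final w.r.t. maps from the topological simplices). *)
Definition delta_generated (T : topologicalType) : Prop :=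
  forall U : set T,
    (forall g : I01 -> T, continuous g -> open (g @^-1` U)) -> open U.

Definition omega_final_paths (I : Type) (X : I -> MdSpace)
    (T : topologicalType) (X0 : set T) (f : forall i, md_carrier (X i) -> T)
    : set (I01 -> T) :=
  [set g | forall P : set (I01 -> T),
      mdspace_axioms X0 P ->
      (forall i (h : I01 -> md_carrier (X i)), md_paths (X i) h -> P (f i \o h)) ->
      P g].

Definition moore_composition (I : Type) (X : I -> MdSpace)
    (T : topologicalType) (f : forall i, md_carrier (X i) -> T)
    (g : I01 -> T) : Prop :=
  exists (n : nat) (idx : 'I_n -> I)
         (gam : forall k : 'I_n, I01 -> md_carrier (X (idx k)))
         (l : 'I_n -> R),
    let s (k : 'I_n) := \sum_(j < n | ltn j k) l j in
    [/\ ltn 0 n,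
        (forall k, md_paths (X (idx k)) (gam k)),
        (forall k, 0 < l k),
        \sum_(k < n) l k = 1 &
        [/\ (forall k k' : 'I_n, (nat_of_ord k').+1 = nat_of_ord k ->
              f (idx k') (gam k' i1) = f (idx k) (gam k i0)) &
            (forall (k : 'I_n) (t : I01), s k <= set_val t <= s k + l k ->
              g t = f (idx k) (gam k (clamp01 ((set_val t - s k) / l k))))]].

Arguments omega_final_paths {I} X {T} X0 f.
Arguments moore_composition {I} X {T} f g.

(* Main.v *)
(** Write [mcomp a g1 g2] for the Moore composition of [g1], rescaled to
    [[0, a]], with [g2], rescaled to [[a, 1]]. A multipointed d-structure is
    stable under every [mcomp a], since [mcomp a g1 g2] is the normalized
    composition reparametrized by the piecewise linear homeomorphism sending [a]
    to [1/2]. Conversely, if [phi] is in [G11] then [mcomp a g1 g2 \o phi] is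
    [mcomp (phi^-1 a)] of reparametrizations of [g1] and [g2], so the closure of
    the paths [f i \o h] under all [mcomp a] is stable under [G11] and is
    therefore the final structure. Unfolding iterated binary compositions
    identifies this closure with the finite Moore compositions. *)

Require Import Defs.
From HB Require Import structures.
From mathcomp Require Import all_boot all_order all_algebra.
From mathcomp Require Import all_classical all_reals all_analysis.
From mathcomp Require Import Rstruct Rstruct_topology ring lra.

Set Implicit Arguments.
Unset Strict Implicit.
Unset Printing Implicit Defensive.
Import Order.TTheory GRing.Theory Num.Theory.
Import numFieldNormedType.Exports.
Local Open Scope classical_set_scope.
Local Open Scope ring_scope.
Local Notation R := Rdefinitions.R.
(* Without this, arguments of [clamp01] would be parsed in Stdlib's [R_scope]. *)
Local Arguments clamp01 x%_ring_scope.

(** * The segment as real coordinates, with clamping as inverse *)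

Definition val01 (t : I01) : R := set_val t.

Lemma val01_itv (t : I01) : 0 <= val01 t <= 1.
Proof. by have := set_mem (valP t); rewrite /= in_itv. Qed.

Lemma val01_inj : injective val01.
Proof. exact: val_inj. Qed.

Lemma clamp01K (x : R) : 0 <= x <= 1 -> val01 (clamp01 x) = x.
Proof.
move=> /andP[x0 x1]; change (Num.min 1 (Num.max 0 x) = x).
by rewrite (max_idPr x0) (min_idPr x1).
Qed.

Lemma val01K : cancel val01 clamp01.
Proof. by move=> t; apply: val01_inj; rewrite clamp01K ?val01_itv. Qed.

Lemma val01_i0 : val01 i0 = 0.
Proof. by rewrite clamp01K // lexx ler01. Qed.

Lemma val01_i1 : val01 i1 = 1.
Proof. by rewrite clamp01K // lexx ler01. Qed.

Lemma continuous_val01 : continuous val01.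
Proof. exact: initial_continuous. Qed.

Lemma continuous_clamp01 : continuous clamp01.
Proof.
apply: continuous_comp_initial => x.
apply: (@continuous_min R R (fun=> 1) (fun x => Num.max 0 x)).
  exact: cst_continuous.
apply: (@continuous_max R R (fun=> 0) (fun x => x)) => //.
exact: cst_continuous.
Qed.

(** The map enters through an equation so that expressions such as [x / a] or [b + (1 - b) * x] can
    be used as they stand. *)
Lemma continuous_affine01 (h : R -> R) (a b : R) :
  (forall x, h x = (x - a) * b) -> continuous (fun t : I01 => clamp01 (h (val01 t))).
Proof.
move=> hE t; apply: (@continuous_comp I01 R I01 (h \o val01) clamp01);
  last exact: continuous_clamp01.
apply: (@continuous_comp _ _ _ val01 h); first exact: continuous_val01.
rewrite (_ : h = (fun x => (x - a) * b)); last exact/funext.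
by apply: cvgM; [apply: cvgB; [exact: cvg_id|exact: cvg_cst]|exact: cvg_cst].
Qed.

(** * Moore composition of two paths with an arbitrary cut *)

Definition mcomp (T : Type) (a : R) (g1 g2 : I01 -> T) (t : I01) : T :=
  if val01 t <= a then g1 (clamp01 (val01 t / a))
  else g2 (clamp01 ((val01 t - a) / (1 - a))).

Lemma mcomp_left (T : Type) (a : R) (g1 g2 : I01 -> T) (t : I01) :
  val01 t <= a -> mcomp a g1 g2 t = g1 (clamp01 (val01 t / a)).
Proof. by rewrite /mcomp => ->. Qed.

(** At the cut itself [mcomp] takes its first branch; both branches agree there because [a / a = 1],
    [(a - a) / (1 - a) = 0] and the endpoints match. The right-hand formula thus holds on a closed
    set, as pasting requires. *)
Lemma mcomp_right (T : Type) (a : R) (g1 g2 : I01 -> T) (t : I01) :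
  0 < a -> g1 i1 = g2 i0 -> a <= val01 t ->
  mcomp a g1 g2 t = g2 (clamp01 ((val01 t - a) / (1 - a))).
Proof.
move=> a0 g12 at_; rewrite /mcomp; case: ifP => // ta.
have -> : val01 t = a by lra.
by rewrite subrr mul0r divff ?gt_eqF.
Qed.

Lemma mcomp_i0 (T : Type) (a : R) (g1 g2 : I01 -> T) :
  0 < a -> mcomp a g1 g2 i0 = g1 i0.
Proof. by move=> a0; rewrite mcomp_left val01_i0 ?ltW// mul0r. Qed.

Lemma mcomp_i1 (T : Type) (a : R) (g1 g2 : I01 -> T) :
  a < 1 -> mcomp a g1 g2 i1 = g2 i1.
Proof.
move=> a1; rewrite /mcomp val01_i1 leNgt a1 /= divff // gt_eqF//; lra.
Qed.

Lemma ncompE (T : Type) (g1 g2 : I01 -> T) : ncomp g1 g2 = mcomp (1 / 2) g1 g2.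
Proof.
apply/funext => t; rewrite /ncomp /mcomp -/(val01 t).
(* In [ncomp] the arguments of [clamp01] use Stdlib's real operations and numerals; they are turned
   into ring operations before [field]. *)
by case: ifP => _; congr (_ (clamp01 _));
  rewrite !(RminusE, RmultE, IZRposE, INRE) ?[nat_of_pos _]/=; field.
Qed.

(** Pasting lemma for the closed cover of the segment by its parts left and right of [a]. *)
Lemma continuous_mcomp (T : topologicalType) (a : R) (g1 g2 : I01 -> T) :
  0 < a -> g1 i1 = g2 i0 -> continuous g1 -> continuous g2 ->
  continuous (mcomp a g1 g2).
Proof.
move=> a0 g12 cg1 cg2; apply/continuous_subspace_setT.
have -> : [set: I01] = [set t | val01 t <= a] `|` [set t | a <= val01 t].
  by apply/seteqP; split => // t _ /=; apply/orP; exact: le_total.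
apply: withinU_continuous.
- exact: (closed_comp (fun t _ => @continuous_val01 t) (@closed_le _ a)).
- exact: (closed_comp (fun t _ => @continuous_val01 t) (@closed_ge _ a)).
- apply: (@subspace_eq_continuous _ _ _ (g1 \o (fun t => clamp01 (val01 t / a)))).
    by move=> t /set_mem ta; apply/esym; exact: mcomp_left.
  apply: continuous_subspaceT => t; apply: continuous_comp; last exact: cg1.
  by apply: (@continuous_affine01 (fun x => x / a) 0 a^-1) => x; rewrite subr0.
- apply: (@subspace_eq_continuous _ _ _
    (g2 \o (fun t => clamp01 ((val01 t - a) / (1 - a))))).
    by move=> t /set_mem ta; apply/esym; exact: mcomp_right.
  apply: continuous_subspaceT => t; apply: continuous_comp; last exact: cg2.
  exact: (@continuous_affine01 (fun x => (x - a) / (1 - a)) a (1 - a)^-1).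
Qed.

(** * Reparametrizations *)

Lemma divr_itv01 (a x : R) : 0 < a -> 0 <= x <= a -> 0 <= x / a <= 1.
Proof.
by move=> a0 /andP[x0 xa]; rewrite divr_ge0 ?(ltW a0)//= ler_pdivrMr ?mul1r.
Qed.

(** Affine from [[0, a]] onto [[0, b]] and from [[a, 1]] onto [[b, 1]]. Writing it as an [mcomp]
    yields its continuity from [continuous_mcomp]. *)
Definition pw_linear (a b : R) : I01 -> I01 :=
  mcomp a (fun t => clamp01 (b * val01 t))
          (fun t => clamp01 (b + (1 - b) * val01 t)).

Lemma val01_pw_linear_left (a b : R) (t : I01) :
  0 < a < 1 -> 0 < b < 1 -> val01 t <= a -> val01 (pw_linear a b t) = b * (val01 t / a).
Proof.
move=> /andP[a0 a1] b01 ta; have t01 := val01_itv t.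
have ta01 : 0 <= val01 t / a <= 1 by apply: divr_itv01 => //; lra.
rewrite /pw_linear mcomp_left// [val01 (clamp01 (val01 t / a))]clamp01K// clamp01K//.
by nra.
Qed.

Lemma val01_pw_linear_right (a b : R) (t : I01) :
  0 < a < 1 -> 0 < b < 1 -> a <= val01 t ->
  val01 (pw_linear a b t) = b + (1 - b) * ((val01 t - a) / (1 - a)).
Proof.
move=> /andP[a0 a1] b01 ta; have t01 := val01_itv t.
have ta01 : 0 <= (val01 t - a) / (1 - a) <= 1 by apply: divr_itv01 => //; lra.
rewrite /pw_linear mcomp_right//; last first.
  by rewrite val01_i1 val01_i0 mulr1 mulr0 addr0.
rewrite [val01 (clamp01 (_ / _))]clamp01K// clamp01K//.
by nra.
Qed.

(** Each point stays on its side of the break point, and there the two affine formulas are mutually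
    inverse. *)
Lemma pw_linearK (a b : R) :
  0 < a < 1 -> 0 < b < 1 -> cancel (pw_linear a b) (pw_linear b a).
Proof.
move=> a01 b01 t; apply: val01_inj; have t01 := val01_itv t.
have [ta|/ltW ta] := leP (val01 t) a.
  have /andP[_ q1] : 0 <= val01 t / a <= 1 by apply: divr_itv01; lra.
  have e := val01_pw_linear_left a01 b01 ta.
  have le_b : val01 (pw_linear a b t) <= b by rewrite e; nra.
  rewrite (val01_pw_linear_left b01 a01 le_b) e; field; lra.
have /andP[q0 _] : 0 <= (val01 t - a) / (1 - a) <= 1 by apply: divr_itv01; lra.
have e := val01_pw_linear_right a01 b01 ta.
have ge_b : b <= val01 (pw_linear a b t) by rewrite e; nra.
rewrite (val01_pw_linear_right b01 a01 ge_b) e; field; lra.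
Qed.

Lemma continuous_pw_linear (a b : R) : 0 < a -> b < 1 -> continuous (pw_linear a b).
Proof.
move=> a0 b1; apply: continuous_mcomp => //.
- by rewrite val01_i1 val01_i0 mulr1 mulr0 addr0.
- by apply: (@continuous_affine01 (fun x => b * x) 0 b) => x; rewrite subr0 mulrC.
(* The constants are the zero and the slope of the affine map. *)
- apply: (@continuous_affine01 (fun x => b + (1 - b) * x) (- (b / (1 - b))) (1 - b)).
  by move=> x; field; lra.
Qed.

Lemma G11_pw_linear (a b : R) : 0 < a < 1 -> 0 < b < 1 -> G11 (pw_linear a b).
Proof.
move=> a01 b01; split; first by apply: continuous_pw_linear; lra.
split.
  exists (pw_linear b a); split; first by apply: continuous_pw_linear; lra.
  by split; exact: pw_linearK.
move=> s t; rewrite -!/(val01 _) => st.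
have s01 := val01_itv s; have t01 := val01_itv t.
have [a0 a1] : 0 < a^-1 /\ 0 < (1 - a)^-1 by rewrite !invr_gt0; lra.
have [sa|/ltW sa] := leP (val01 s) a; have [ta|/ltW ta] := leP (val01 t) a.
- rewrite !val01_pw_linear_left//; apply: ler_wpM2l; first lra.
  by apply: ler_wpM2r => //; lra.
(* The value [b] at the break point separates the two images. *)
- rewrite val01_pw_linear_left// val01_pw_linear_right//.
  have /andP[_ q1] : 0 <= val01 s / a <= 1 by apply: divr_itv01; lra.
  have /andP[q0 _] : 0 <= (val01 t - a) / (1 - a) <= 1 by apply: divr_itv01; lra.
  by nra.
(* Here [t] is left of [a] and [s] right of it, so [s <= t] forces both to equal [a]. *)
- have -> : s = t by apply: val01_inj; lra.
  exact: lexx.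
- rewrite !val01_pw_linear_right// lerD2l; apply: ler_wpM2l; first lra.
  by apply: ler_wpM2r; lra.
Qed.

Lemma mcomp_pw_linear (T : Type) (a b : R) (g1 g2 : I01 -> T) :
  0 < a < 1 -> 0 < b < 1 -> g1 i1 = g2 i0 ->
  mcomp a g1 g2 = mcomp b g1 g2 \o pw_linear a b.
Proof.
move=> a01 b01 g12; apply/funext => t /=; have t01 := val01_itv t.
have [ta|/ltW ta] := leP (val01 t) a.
  have /andP[_ q1] : 0 <= val01 t / a <= 1 by apply: divr_itv01; lra.
  have e := val01_pw_linear_left a01 b01 ta.
  have le_b : val01 (pw_linear a b t) <= b by rewrite e; nra.
  rewrite !mcomp_left// e.
  by congr (g1 (clamp01 _)); field; lra.
have /andP[q0 _] : 0 <= (val01 t - a) / (1 - a) <= 1 by apply: divr_itv01; lra.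
have e := val01_pw_linear_right a01 b01 ta.
have ge_b : b <= val01 (pw_linear a b t) by rewrite e; nra.
rewrite !mcomp_right// ?e; [|lra|lra].
by congr (g2 (clamp01 _)); field; lra.
Qed.

(** Since [i0] is the image of [psi i0], monotonicity bounds [phi i0] above by [i0]. *)
Lemma G11_i0 (phi : I01 -> I01) : G11 phi -> phi i0 = i0.
Proof.
move=> [_ [[psi [_ [_ psiK]]] phi_le]]; apply: val01_inj.
have := phi_le i0 (psi i0); rewrite psiK -!/(val01 _) val01_i0.
by have := val01_itv (psi i0); have := val01_itv (phi i0); lra.
Qed.

Lemma G11_i1 (phi : I01 -> I01) : G11 phi -> phi i1 = i1.
Proof.
move=> [_ [[psi [_ [_ psiK]]] phi_le]]; apply: val01_inj.
have := phi_le (psi i1) i1; rewrite psiK -!/(val01 _) val01_i1.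
by have := val01_itv (psi i1); have := val01_itv (phi i1); lra.
Qed.

Lemma G11_lt (phi : I01 -> I01) (s t : I01) :
  G11 phi -> val01 s < val01 t -> val01 (phi s) < val01 (phi t).
Proof.
move=> [_ [[psi [_ [phiK _]]] phi_le]] st; rewrite lt_neqAle phi_le ?andbT ?ltW//.
by apply/eqP => /val01_inj/(can_inj phiK) e; rewrite e ltxx in st.
Qed.

(** If [psi] reversed a pair, strict monotonicity of [phi] would reverse it back, a
    contradiction. *)
Lemma G11_inv (phi psi : I01 -> I01) :
  G11 phi -> continuous psi -> cancel phi psi -> cancel psi phi -> G11 psi.
Proof.
move=> Gphi cpsi phiK psiK; split => //; split.
  by case: Gphi => cphi _; exists phi.
move=> s t; rewrite -!/(val01 _) => st; rewrite leNgt; apply/negP.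
by move=> /(G11_lt Gphi); rewrite !psiK; lra.
Qed.

(* [phi] restricted to a map from [[u, v]] to [[x, y]], both rescaled to [[0, 1]]. *)
Definition rescale (phi : I01 -> I01) (u v x y : R) (s : I01) : I01 :=
  clamp01 ((val01 (phi (clamp01 (u + (v - u) * val01 s))) - x) / (y - x)).

Lemma continuous_rescale (phi : I01 -> I01) (u v x y : R) :
  u < v -> continuous phi -> continuous (rescale phi u v x y).
Proof.
move=> uv cphi s.
apply: (@continuous_comp _ _ _ (phi \o (fun s => clamp01 (u + (v - u) * val01 s)))
  (fun r => clamp01 ((val01 r - x) / (y - x)))); last first.
  exact: (@continuous_affine01 (fun r => (r - x) / (y - x)) x (y - x)^-1).
apply: continuous_comp; last exact: cphi.
apply: (@continuous_affine01 (fun r => u + (v - u) * r) (- (u / (v - u))) (v - u)).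
by move=> r; field; lra.
Qed.

(** By monotonicity [phi] maps [[u, v]] into [[phi u, phi v]], so no clamp truncates; the affine
    factors cancel and [psi \o phi] remains. *)
Lemma rescaleK (phi psi : I01 -> I01) (u v : I01) :
  G11 phi -> cancel phi psi -> val01 u < val01 v ->
  cancel (rescale phi (val01 u) (val01 v) (val01 (phi u)) (val01 (phi v)))
         (rescale psi (val01 (phi u)) (val01 (phi v)) (val01 u) (val01 v)).
Proof.
move=> Gphi phiK uv s; apply: val01_inj.
have u01 := val01_itv u; have v01 := val01_itv v; have s01 := val01_itv s.
have xy := G11_lt Gphi uv.
have [_ [_ phi_le]] := Gphi.
rewrite /rescale; set w := clamp01 (val01 u + _).
have we : val01 w = val01 u + (val01 v - val01 u) * val01 s.
  by rewrite clamp01K//; nra.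
have xw : val01 (phi u) <= val01 (phi w).
  by apply: phi_le; rewrite -!/(val01 _) we; nra.
have wy : val01 (phi w) <= val01 (phi v).
  by apply: phi_le; rewrite -!/(val01 _) we; nra.
rewrite [val01 (clamp01 ((val01 (phi w) - _) / _))]clamp01K; last first.
  by apply: divr_itv01; lra.
rewrite [(val01 (phi v) - _) * _]mulrC divfK ?gt_eqF ?subr_gt0//.
rewrite subrKC val01K phiK we clamp01K; first by field; lra.
by apply: divr_itv01; nra.
Qed.

Lemma G11_rescale (phi : I01 -> I01) (u v : I01) :
  G11 phi -> val01 u < val01 v ->
  G11 (rescale phi (val01 u) (val01 v) (val01 (phi u)) (val01 (phi v))).
Proof.
move=> Gphi uv; have xy := G11_lt Gphi uv.
have [cphi [[psi [cpsi [phiK psiK]]] phi_le]] := Gphi.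
have Gpsi := G11_inv Gphi cpsi phiK psiK.
split; first exact: continuous_rescale.
split.
  exists (rescale psi (val01 (phi u)) (val01 (phi v)) (val01 u) (val01 v)).
  split; first exact: continuous_rescale.
  split; first exact: rescaleK.
  (* The roles are exchanged: [psi] on [[phi u, phi v]], whose ends it sends back to [u] and [v]. *)
  by have := rescaleK Gpsi psiK xy; rewrite !phiK.
move=> s t; rewrite -!/(val01 _) => st.
have u01 := val01_itv u; have v01 := val01_itv v.
have s01 := val01_itv s; have t01 := val01_itv t.
have bnd (r : I01) : val01 (phi u) <=
    val01 (phi (clamp01 (val01 u + (val01 v - val01 u) * val01 r))) <= val01 (phi v).
  have r01 := val01_itv r.
  by apply/andP; split; apply: phi_le; rewrite -!/(val01 _) clamp01K; nra.
have bs := bnd s; have bt := bnd t.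
rewrite !clamp01K; [|apply: divr_itv01; lra..].
apply: ler_wpM2r; first by rewrite invr_ge0; lra.
by rewrite lerD2r; apply: phi_le; rewrite -!/(val01 _) !clamp01K; nra.
Qed.

(** The new cut [b] is the preimage of [a] under [phi]; [phi1] and [phi2] are the restrictions of
    [phi] to both sides of it, rescaled. *)
Lemma mcomp_G11 (T : Type) (a : R) (g1 g2 : I01 -> T) (phi : I01 -> I01) :
  0 < a < 1 -> g1 i1 = g2 i0 -> G11 phi ->
  exists b phi1 phi2, [/\ 0 < b < 1, G11 phi1, G11 phi2 &
    mcomp a g1 g2 \o phi = mcomp b (g1 \o phi1) (g2 \o phi2)].
Proof.
move=> a01 g12 Gphi.
have [_ [[psi [cpsi [phiK psiK]]] phi_le]] := Gphi.
have Gpsi := G11_inv Gphi cpsi phiK psiK.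
have ca : val01 (clamp01 a) = a by rewrite clamp01K//; lra.
set c := psi (clamp01 a); have phic : val01 (phi c) = a by rewrite psiK.
have c0 : val01 i0 < val01 c.
  by rewrite -(G11_i0 Gpsi); apply: G11_lt => //; rewrite ca val01_i0; lra.
have c1 : val01 c < val01 i1.
  by rewrite -(G11_i1 Gpsi); apply: G11_lt => //; rewrite ca val01_i1; lra.
have G1 := G11_rescale Gphi c0; have G2 := G11_rescale Gphi c1.
(* The endpoints of the two rescalings become the numbers [0], [a], [1] and the new cut. *)
move: (G1) (G2); rewrite phic (G11_i0 Gphi) (G11_i1 Gphi) val01_i0 val01_i1.
set phi1 := rescale _ _ _ _ _; set phi2 := rescale _ _ _ _ _ => {}G1 {}G2.
exists (val01 c), phi1, phi2; split => //.
  by rewrite -{1}val01_i0 -val01_i1 c0.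
have phi12 : (g1 \o phi1) i1 = (g2 \o phi2) i0.
  by rewrite /= (G11_i1 G1) (G11_i0 G2).
rewrite val01_i0 in c0; rewrite val01_i1 in c1.
apply/funext => t /=; have t01 := val01_itv t.
have [tc|/ltW tc] := leP (val01 t) (val01 c).
  rewrite !mcomp_left//; last by rewrite -phic; exact: phi_le.
  congr (g1 _); rewrite /phi1 /rescale !subr0 add0r clamp01K; last first.
    by apply: divr_itv01; lra.
  by rewrite [val01 c * _]mulrC divfK ?gt_eqF// val01K.
rewrite !mcomp_right//; [|lra|by rewrite -phic; exact: phi_le].
congr (g2 _); rewrite /phi2 /rescale clamp01K; last by apply: divr_itv01; lra.
rewrite [(1 - val01 c) * _]mulrC divfK ?gt_eqF ?subr_gt0//.
by rewrite subrKC val01K.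
Qed.

(** * Closure under binary Moore compositions *)

(** Allowing every cut [a], and not just [1 / 2], is what lets stability under [G11] pass from [B]
    to its closure. *)
Inductive chain (T : Type) (B : set (I01 -> T)) : set (I01 -> T) :=
| chain_base g : B g -> chain B g
| chain_mcomp a g1 g2 : 0 < a < 1 -> g1 i1 = g2 i0 ->
    chain B g1 -> chain B g2 -> chain B (mcomp a g1 g2).

Lemma mdspace_mcomp (T : topologicalType) (X0 : set T) (P : set (I01 -> T))
    (a : R) (g1 g2 : I01 -> T) :
  mdspace_axioms X0 P -> 0 < a < 1 -> g1 i1 = g2 i0 -> P g1 -> P g2 ->
  P (mcomp a g1 g2).
Proof.
move=> [_ _ PG Pncomp] a01 g12 Pg1 Pg2.
have half01 : 0 < (1 / 2 : R) < 1 by lra.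
rewrite (mcomp_pw_linear a01 half01 g12) -ncompE.
by apply: PG; [exact: Pncomp|exact: G11_pw_linear].
Qed.

Lemma chain_min (T : topologicalType) (X0 : set T) (B P : set (I01 -> T)) :
  mdspace_axioms X0 P -> B `<=` P -> chain B `<=` P.
Proof.
move=> Pax BP g; elim => [{}g /BP//|a g1 g2 a01 g12 _ Pg1 _ Pg2].
exact: (mdspace_mcomp Pax).
Qed.

Lemma chain_mdspace (T : topologicalType) (X0 : set T) (B : set (I01 -> T)) :
  (forall g, B g -> continuous g) ->
  (forall g, B g -> X0 (g i0) /\ X0 (g i1)) ->
  (forall g phi, B g -> G11 phi -> B (g \o phi)) ->
  mdspace_axioms X0 (chain B).
Proof.
move=> Bcont Bends BG; split.
- move=> g; elim => [{}g /Bcont//|a g1 g2 /andP[a0 _] g12 _ cg1 _ cg2].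
  exact: continuous_mcomp.
- move=> g; elim => [{}g /Bends//|a g1 g2 /andP[a0 a1] _ _ [g10 _] _ [_ g21]].
  by rewrite mcomp_i0// mcomp_i1.
(* [phi] stays universally quantified in the induction, since each factor receives its own
   reparametrization. *)
- move=> g phi Bg; elim: Bg phi => [{}g Bg phi Gphi|].
    by apply: chain_base; exact: BG.
  move=> a g1 g2 a01 g12 _ IH1 _ IH2 phi Gphi.
  have [b [phi1 [phi2 [b01 G1 G2 ->]]]] := mcomp_G11 a01 g12 Gphi.
  apply: chain_mcomp => //; [|exact: IH1|exact: IH2].
  by rewrite /= (G11_i1 G1) (G11_i0 G2).
- move=> g1 g2 Bg1 Bg2 g12; rewrite ncompE; apply: chain_mcomp => //; lra.
Qed.

(** * Finite Moore compositions *)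

(* The families are indexed by [nat] and only their first [n] terms matter. *)
Definition moore (T : Type) (B : set (I01 -> T)) (n : nat) (p : nat -> I01 -> T)
    (l : nat -> R) (g : I01 -> T) : Prop :=
  [/\ forall k, (k < n)%N -> B (p k),
      forall k, (k < n)%N -> 0 < l k,
      \sum_(j < n) l j = 1,
      forall k, (k.+1 < n)%N -> p k i1 = p k.+1 i0 &
      forall k t, (k < n)%N ->
        \sum_(j < k) l j <= val01 t <= \sum_(j < k) l j + l k ->
        g t = p k (clamp01 ((val01 t - \sum_(j < k) l j) / l k))].

Section MooreConcatenation.
Variables (T : Type) (B : set (I01 -> T)).

Lemma sum_lengths_ge0 (n k : nat) (l : nat -> R) :
  (forall j, (j < n)%N -> 0 < l j) -> (k <= n)%N -> 0 <= \sum_(j < k) l j.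
Proof.
move=> l0 kn; apply: sumr_ge0 => j _; apply/ltW/l0.
exact: leq_trans (ltn_ord j) kn.
Qed.

Lemma sum_lengths_le (n k : nat) (l : nat -> R) :
  (forall j, (j < n)%N -> 0 < l j) -> (k <= n)%N ->
  \sum_(j < k) l j <= \sum_(j < n) l j.
Proof.
move=> l0; elim: n l0 => [|n IH] l0; first by rewrite leqn0 => /eqP ->.
rewrite leq_eqVlt => /predU1P[->//|kn]; rewrite big_ord_recr /=.
have le_n := IH (fun j jn => l0 j (ltnW jn)) kn.
by have := l0 n (ltnSn n); lra.
Qed.

Lemma moore_i0 n p l g : moore B n.+1 p l g -> g i0 = p 0%N i0.
Proof.
move=> [_ l0 _ _ gE]; rewrite (gE 0%N i0)// big_ord0 val01_i0 ?subr0 ?mul0r//.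
by rewrite add0r lexx /= ltW// l0.
Qed.

Lemma moore_i1 n p l g : moore B n.+1 p l g -> g i1 = p n i1.
Proof.
move=> [_ l0 s1 _ gE]; have ln := l0 n (ltnSn n).
rewrite big_ord_recr /= in s1.
rewrite (gE n i1)// val01_i1 -s1; last by rewrite lerDl lexx ltW.
by rewrite addrAC subrr add0r divff// gt_eqF.
Qed.

Lemma moore_base g : B g -> moore B 1 (fun=> g) (fun=> 1) g.
Proof.
move=> Bg; split => //.
- by rewrite big_ord1.
- by case=> // t _ _; rewrite big_ord0 subr0 divr1 val01K.
Qed.

(** Both subdivisions of the segment are shrunk, by [a] and by [1 - a], and placed side by side. *)
Lemma moore_concat n1 n2 p1 p2 l1 l2 a g1 g2 :
  0 < a < 1 -> g1 i1 = g2 i0 ->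
  moore B n1.+1 p1 l1 g1 -> moore B n2.+1 p2 l2 g2 ->
  moore B (n1.+1 + n2.+1)
    (fun k => if (k < n1.+1)%N then p1 k else p2 (k - n1.+1)%N)
    (fun k => if (k < n1.+1)%N then a * l1 k else (1 - a) * l2 (k - n1.+1)%N)
    (mcomp a g1 g2).
Proof.
move=> a01 g12 m1 m2.
have g1i1 := moore_i1 m1; have g2i0 := moore_i0 m2.
case: m1 => B1 l10 s1 c1 g1E; case: m2 => B2 l20 s2 c2 g2E.
set p := fun k => _; set l := fun k => _.
have sl k : (k <= n1.+1)%N -> \sum_(j < k) l j = a * \sum_(j < k) l1 j.
  move=> kn; rewrite big_distrr /=; apply: eq_bigr => j _.
  by rewrite /l (leq_trans (ltn_ord j) kn).
have sr k : \sum_(j < n1.+1 + k) l j = a + (1 - a) * \sum_(j < k) l2 j.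
  rewrite big_split_ord /= big_distrr /=; congr (_ + _).
    by rewrite (sl n1.+1)// s1 mulr1.
  by apply: eq_bigr => j _; rewrite /l ltnNge leq_addr /= addKn.
have right k : (n1.+1 <= k)%N -> (k < n1.+1 + n2.+1)%N ->
    exists2 k', (k' < n2.+1)%N & k = (n1.+1 + k')%N.
  move=> n1k kn; exists (k - n1.+1)%N; last by rewrite subnKC.
  by rewrite ltn_subLR.
have pright k : p (n1.+1 + k)%N = p2 k by rewrite /p ltnNge leq_addr /= addKn.
have lright k : l (n1.+1 + k)%N = (1 - a) * l2 k by rewrite /l ltnNge leq_addr /= addKn.
have pleft k : (k < n1.+1)%N -> p k = p1 k by rewrite /p => ->.
have lleft k : (k < n1.+1)%N -> l k = a * l1 k by rewrite /l => ->.
split.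
- move=> k kn; case: (ltnP k n1.+1) => [k1|/right/(_ kn)[k' k'n ->]].
    by rewrite pleft//; exact: B1.
  by rewrite pright; exact: B2.
- move=> k kn; case: (ltnP k n1.+1) => [k1|/right/(_ kn)[k' k'n ->]].
    by rewrite lleft// mulr_gt0 ?l10//; lra.
  by rewrite lright mulr_gt0 ?l20//; lra.
- by rewrite sr s2 mulr1 subrKC.
- move=> k kn; case: (ltnP k n1.+1) => [k1|n1k].
    move: k1; rewrite ltnS leq_eqVlt => /predU1P[->|k1].
      (* The junction between the two families: the last piece of [g1] meets the first piece of
         [g2]. *)
      by rewrite pleft// -[n1.+1]addn0 pright -g1i1 -g2i0.
    by rewrite !pleft ?c1// ltnS ltnW.
  have [k' k'n kE] := right _ n1k (ltnW kn).
  by rewrite kE -addnS !pright c2// -(ltn_add2l n1.+1) addnS -kE.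
- move=> k t kn; have t01 := val01_itv t.
  case: (ltnP k n1.+1) => [k1|/right/(_ kn)[k' k'n ->]].
    rewrite sl 1?ltnW// lleft// pleft// -mulrDr => /andP[ts te].
    have lk := l10 _ k1.
    (* The piece ends no later than [1] within [g1], hence no later than [a] after shrinking. *)
    have le1 : \sum_(j < k) l1 j + l1 k <= 1.
      by rewrite -s1; have := sum_lengths_le l10 k1; rewrite big_ord_recr.
    have ta : val01 t <= a by nra.
    have tE : val01 (clamp01 (val01 t / a)) = val01 t / a.
      by rewrite clamp01K//; apply: divr_itv01; lra.
    rewrite mcomp_left// (g1E k)// tE; last first.
      by rewrite ler_pdivlMr ?ler_pdivrMr 1?mulrC ?ts 1?mulrC //; lra.
    by congr (p1 k (clamp01 _)); field; lra.
  rewrite sr lright pright => /andP[ts te].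
  have lk := l20 _ k'n.
  have ge0 := sum_lengths_ge0 l20 (ltnW k'n).
  have ta : a <= val01 t by nra.
  have tE : val01 (clamp01 ((val01 t - a) / (1 - a))) = (val01 t - a) / (1 - a).
    by rewrite clamp01K//; apply: divr_itv01; lra.
  rewrite mcomp_right//; last lra.
  rewrite (g2E k')// tE; last first.
    by rewrite ler_pdivlMr ?ler_pdivrMr; lra.
  by congr (p2 k' (clamp01 _)); field; lra.
Qed.

Lemma chain_moore g : chain B g -> exists n p l, moore B n.+1 p l g.
Proof.
elim=> [{}g Bg|a g1 g2 a01 g12 _ [n1 [p1 [l1 m1]]] _ [n2 [p2 [l2 m2]]]].
  by exists 0%N; do 2 eexists; exact: moore_base.
(* The count [n1.+1 + n2.+1] is convertible to [(n1 + n2.+1).+1]. *)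
by exists (n1 + n2.+1)%N; do 2 eexists; exact: (moore_concat a01 g12 m1 m2).
Qed.

(** Induction on the number of pieces: the first is split off with the cut at its length, and the
    rest is stretched to the whole segment. *)
Lemma moore_chain n p l g : moore B n.+1 p l g -> chain B g.
Proof.
elim: n p l g => [|n IH] p l g [Bp l0 s1 c gE].
  move: s1; rewrite big_ord_recr big_ord0 /= add0r => l01.
  suff -> : g = p 0%N by apply/chain_base/Bp.
  apply/funext => t; rewrite (gE 0%N t)// big_ord0 l01.
    by rewrite subr0 divr1 val01K.
  by rewrite add0r val01_itv.
set a := l 0%N; have a0 : 0 < a by exact: l0.
have a1 : a < 1.
  (* At least two pieces have positive length, so the first cannot fill the segment. *)
  have := sum_lengths_le l0 (isT : (1 < n.+2)%N).
  rewrite s1 !big_ord_recr big_ord0 /= -/a.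
  by have := l0 1%N isT; lra.
(* The remainder is read off from [g] itself, so that recomposing it only inverts an affine map. *)
pose g2 t := g (clamp01 (a + (1 - a) * val01 t)).
have ga t : val01 t <= a -> g t = p 0%N (clamp01 (val01 t / a)).
  move=> ta; rewrite (gE 0%N t)// big_ord0 ?subr0//.
  by have := val01_itv t; rewrite add0r -/a; lra.
have g12 : p 0%N i1 = g2 i0.
  rewrite /g2 val01_i0 mulr0 addr0 ga clamp01K ?divff ?gt_eqF//; lra.
have -> : g = mcomp a (p 0%N) g2.
  apply/funext => t; have t01 := val01_itv t; have [ta|/ltW ta] := leP (val01 t) a.
    by rewrite mcomp_left// ga.
  rewrite mcomp_right// /g2 clamp01K; last by apply: divr_itv01; lra.
  by rewrite [(1 - a) * _]mulrC divfK ?gt_eqF ?subr_gt0// subrKC val01K.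
apply: chain_mcomp => //; [by rewrite a0|exact/chain_base/Bp|].
apply: (IH (fun k => p k.+1) (fun k => l k.+1 / (1 - a))).
(* Partial sums of the remaining lengths: shifted by the removed piece, then divided by [1 - a]. *)
have sE k : \sum_(j < k) l j.+1 / (1 - a) = (\sum_(j < k.+1) l j - a) / (1 - a).
  by rewrite -big_distrl /= big_ord_recl /= -/a addrAC subrr add0r.
split.
- by move=> k kn; exact: Bp.
- by move=> k kn; rewrite divr_gt0 ?l0// subr_gt0.
- by rewrite sE s1 divff// gt_eqF// subr_gt0.
- by move=> k kn; exact: c.
- move=> k t kn; rewrite sE; set s := \sum_(j < k.+1) l j => st.
  have t01 := val01_itv t.
  have tE : val01 (clamp01 (a + (1 - a) * val01 t)) = a + (1 - a) * val01 t.
    by rewrite clamp01K//; nra.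
  have lk : 0 < l k.+1 by exact: l0.
  rewrite /g2 (gE k.+1)// tE -/s.
    by congr (p _ (clamp01 _)); field; lra.
  move: st; rewrite -mulrDl ler_pdivrMr ?ler_pdivlMr ?subr_gt0//; lra.
Qed.

End MooreConcatenation.

(** * Identification of the final structure *)

Definition image_paths (I : Type) (X : I -> MdSpace) (T : topologicalType)
    (f : forall i, md_carrier (X i) -> T) : set (I01 -> T) :=
  [set b | exists i, exists2 h, md_paths (X i) h & b = f i \o h].

Lemma moore_compositionE (I : Type) (X : I -> MdSpace) (T : topologicalType)
    (f : forall i, md_carrier (X i) -> T) (g : I01 -> T) :
  moore_composition X f g <-> exists n p l, moore (image_paths f) n.+1 p l g.
Proof.
split.
  move=> [[|n] [idx [gam [l []]]]] // _ Pgam l0 s1 [c gE].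
  (* [inord] extends families on ordinals to all of [nat]; its default value beyond [n] is never
     consulted. *)
  exists n, (fun k => f (idx (inord k)) \o gam (inord k)), (fun k => l (inord k)).
  have sE k : (k <= n.+1)%N ->
      \sum_(j < k) l (inord j) = \sum_(j < n.+1 | (j < k)%N) l j.
    move=> kn; rewrite (big_ord_widen _ (fun j => l (inord j)) kn).
    by apply: eq_bigr => j _; rewrite inord_val.
  split.
  - by move=> k _; exists (idx (inord k)), (gam (inord k)).
  - by move=> k _; exact: l0.
  - by under eq_bigr do rewrite inord_val.
  - by move=> k kn; apply: c; rewrite !inordK// ltnW.
  - move=> k t kn; rewrite sE 1?ltnW//= => st.
    by rewrite (gE (inord k)) ?inordK.
move=> [n [p [l [Bp l0 s1 c gE]]]].
(* Choice selects, for each piece, an index and an execution path that it comes from. *)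
have ex (k : 'I_n.+1) :
    {i | exists2 h, md_paths (X i) h & p k = f i \o h}.
  exact/cid/Bp/ltn_ord.
pose idx k := sval (ex k); pose gam k := s2val (cid2 (svalP (ex k))).
have gamP k : md_paths (X (idx k)) (gam k) by exact: (s2valP (cid2 (svalP (ex k)))).
have pE (k : 'I_n.+1) : p k = f (idx k) \o gam k.
  exact: (s2valP' (cid2 (svalP (ex k)))).
exists n.+1, idx, gam, (fun k => l k); split => //.
  by move=> k; exact: l0.
split.
  move=> k k' k'k; move: (c k'); rewrite {1 2}k'k ltn_ord => /(_ isT).
  by rewrite !pE.
move=> k t; have kn := ltn_ord k.
rewrite -(big_ord_widen _ l (ltnW kn)) => st.
by rewrite (gE k t)// pE.
Qed.

Theorem theorem3p9 (I : Type) (X : I -> MdSpace)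
    (T : topologicalType) (X0 : set T)
    (f : forall i, md_carrier (X i) -> T)
    (hdgT : delta_generated T)
    (hdgX : forall i, delta_generated (md_carrier (X i)))
    (hcont : forall i, continuous (f i))
    (hstates : forall i x, md_states (X i) x -> X0 (f i x)) :
  omega_final_paths X X0 f = [set g | moore_composition X f g].
Proof.
have -> : omega_final_paths X X0 f = chain (image_paths f).
  apply/seteqP; split => [g|g cg P Pax fP].
    (* The final structure lies in every admissible one, in particular in the chain closure. *)
    apply; last by move=> i h Ph; apply: chain_base; exists i, h.
    apply: chain_mdspace =>
      [_ [i [h Ph ->]] t|_ [i [h Ph ->]]|_ phi [i [h Ph ->]] Gphi].
    - by apply: continuous_comp; [case: (md_ax (X i)) => + _ _ _; exact|exact: hcont].
    - case: (md_ax (X i)) => _ /(_ _ Ph)[h0 h1] _ _.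
      by split; exact: hstates.
    - exists i, (h \o phi) => //.
      by case: (md_ax (X i)) => _ _ + _; exact.
  by apply: (chain_min Pax _ cg) => _ [i [h Ph ->]]; exact: fP.
apply/seteqP; split => g /=; rewrite moore_compositionE; first exact: chain_moore.
by move=> [n [p [l]]]; exact: moore_chain.
Qed.
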